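(* There exists a variety $\mathfrak{W}$ of local smooth diassociative loops which is non-Moufang (i.e. not every local loop in $\mathfrak{W}$ is a local Moufang loop) and such that the statement of the Moufang Theorem holds for every local loop in $\mathfrak{W}$: if elements $a,b,c$ of a local loop $Q\in\mathfrak{W}$ (sufficiently close to the identity) satisfy $(ab)c=a(bc)$, then the local subloop of $Q$ generated by $a,b,c$ is a local group.
   Context: A loop is a set $Q$ with a binary operation and an element $1$ such that $x\cdot 1=x=1\cdot x$ for all $x$ and the equations $x\cdot a=b$, $a\cdot y=b$ have unique solutions for all $a,b\in Q$. A local smooth loop is a (finite-dimensional real) smooth manifold $Q$ with a distinguished point $1$ and a smooth partial multiplication, defined for pairs of points near $(1,1)$, together with smooth left and right divisions defined near $(1,1)$, such that $x\cdot 1=x=1\cdot x$ and the multiplication and divisions satisfy the loop axioms for elements sufficiently close to $1$. Local loops are considered up to restriction to smaller neighbourhoods of $1$, and an identity holds in a local loop if it holds for all elements of some neighbourhood of $1$. For a sufficiently small neighbourhood $U$ of $1$, the local subloop generated by elements of $U$ is the smallest subset of $U$ that contains these elements and $1$ and is closed under those products and left and right divisions (of its elements) that are defined and lie in $U$. It is a local group if $(xy)z=x(yz)$ for all its elements $x,y,z$ for which all the products involved are defined and lie in $U$. The phrase ''sufficiently close to the identity'' means: there is a neighbourhood $U$ of $1$ in $Q$ such that the assertion holds for all $a,b,c\in U$, with the generated local subloop taken in $U$. A local loop is diassociative if (in a sufficiently small neighbourhood of $1$) every two elements generate a local subloop that is a local group. A local Moufang loop is a local loop satisfying the identity $((xy)x)z=x(y(xz))$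 in a neighbourhood of $1$. A variety of local smooth diassociative loops is the class of all local smooth diassociative loops that satisfy some given set of loop identities (identities in multiplication, left and right division, and $1$) in neighbourhoods of $1$. *)

(* Defs.v *)
(* MathComp / MathComp-Analysis *)
From HB Require Import structures.
From mathcomp Require Import all_boot all_order all_algebra.
From mathcomp Require Import all_classical all_reals all_analysis.
Import Order.TTheory GRing.Theory Num.Theory.
Import numFieldNormedType.Exports.

Set Implicit Arguments.
Unset Strict Implicit.
Unset Printing Implicit Defensive.

Local Open Scope classical_set_scope.
Local Open Scope ring_scope.

(* Only used for open A and finite-dimensional V, where having continuous
   directional derivatives of order at most k in all directions is the usual
   notion of a C^k map. *)
Fixpoint Ck_on (R : realType) (V W : normedModType R) (k : nat)
    (A : set V) (f : V -> W) : Prop :=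
  {in A, continuous f} /\
  if k is k'.+1 then
    forall v : V, (forall x, A x -> derivable f x v) /\ Ck_on k' A ('D_v f)
  else True.

Definition smooth_on (R : realType) (V W : normedModType R)
    (A : set V) (f : V -> W) : Prop :=
  forall k : nat, Ck_on k A f.

(* A chart is defined on chart_dom; the values of chart_to outside chart_dom
   and of chart_from outside the image of chart_dom are irrelevant. *)
Record chart (R : realType) (n : nat) (M : topologicalType) := Chart {
  chart_dom : set M;
  chart_to : M -> 'rV[R]_n;
  chart_from : 'rV[R]_n -> M;
  chart_dom_open : open chart_dom;
  chart_im_open : open (chart_to @` chart_dom);
  chart_to_continuous : {in chart_dom, continuous chart_to};
  chart_from_continuous : {in chart_to @` chart_dom, continuous chart_from};
  chart_toK : {in chart_dom, cancel chart_to chart_from} }.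

Definition chart_im (R : realType) (n : nat) (M : topologicalType)
    (c : chart R n M) : set 'rV[R]_n :=
  chart_to c @` chart_dom c.

Record smooth_manifold (R : realType) := SmoothManifold {
  manifold_sort :> topologicalType;
  manifold_dim : nat;
  atlas : set (chart R manifold_dim manifold_sort);
  manifold_hausdorff : hausdorff_space manifold_sort;
  manifold_second_countable : @second_countable manifold_sort;
  atlas_cover : forall x : manifold_sort, exists2 c, atlas c & chart_dom c x;
  atlas_compatible : forall c d, atlas c -> atlas d ->
    smooth_on (chart_to c @` (chart_dom c `&` chart_dom d))
              (chart_to d \o chart_from c) }.

(* Smoothness on an open set D of M x M of a binary operation on M. *)
Definition smooth_op_on (R : realType) (M : smooth_manifold R)
    (D : set (M * M)) (f : M -> M -> M) : Prop :=
  {in D, continuous (fun p : M * M => f p.1 p.2)} /\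
  forall c1 c2 c3 : chart R (manifold_dim M) M,
    atlas c1 -> atlas c2 -> atlas c3 ->
    smooth_on
      [set u : 'rV[R]_(manifold_dim M) * 'rV[R]_(manifold_dim M) |
        [/\ chart_im c1 u.1, chart_im c2 u.2,
            D (chart_from c1 u.1, chart_from c2 u.2) &
            chart_dom c3 (f (chart_from c1 u.1) (chart_from c2 u.2))]]
      (fun u => chart_to c3 (f (chart_from c1 u.1) (chart_from c2 u.2))).

(* A partial operation is given by its domain and a total function whose values
   outside the domain are irrelevant. *)
Record local_op (R : realType) (M : smooth_manifold R) (e : M) := LocalOp {
  op_dom : set (M * M);
  op_fun :> M -> M -> M;
  op_dom_open : open op_dom;
  op_dom_one : op_dom (e, e);
  op_smooth : smooth_op_on op_dom op_fun }.

(* lldiv x y is x \ y (so x (x \ y) = y) and lrdiv x y is x / y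
   (so (x / y) y = x).  Near the identity, all the operations in the equations
   below are defined, by continuity. *)
Record local_loop (R : realType) := LocalLoop {
  loop_carrier :> smooth_manifold R;
  lone : loop_carrier;
  lmul : local_op lone;
  lldiv : local_op lone;
  lrdiv : local_op lone;
  lmulx1 : \forall x \near lone, lmul x lone = x;
  lmul1x : \forall x \near lone, lmul lone x = x;
  lmulKldiv : \forall p \near (lone, lone), lldiv p.1 (lmul p.1 p.2) = p.2;
  lldivKmul : \forall p \near (lone, lone), lmul p.1 (lldiv p.1 p.2) = p.2;
  lmulKrdiv : \forall p \near (lone, lone), lrdiv (lmul p.1 p.2) p.2 = p.1;
  lrdivKmul : \forall p \near (lone, lone), lmul (lrdiv p.1 p.2) p.2 = p.1 }.

Arguments lone {R} l.
Arguments lmul {R} l.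
Arguments lldiv {R} l.
Arguments lrdiv {R} l.

Inductive loop_term : Type :=
  | TVar of nat
  | TOne
  | TMul of loop_term & loop_term
  | TLDiv of loop_term & loop_term
  | TRDiv of loop_term & loop_term.

Definition loop_identity : Type := (loop_term * loop_term)%type.

Definition op_apply (R : realType) (M : smooth_manifold R) (e : M)
    (o : local_op e) (x y : option M) : option M :=
  obind (fun a => obind (fun b =>
    if (a, b) \in op_dom o then Some (o a b) else None) y) x.

Fixpoint eval (R : realType) (Q : local_loop R) (v : nat -> Q) (t : loop_term) :
    option Q :=
  match t with
  | TVar i => Some (v i)
  | TOne => Some (lone Q)
  | TMul s t => op_apply (lmul Q) (eval v s) (eval v t)
  | TLDiv s t => op_apply (lldiv Q) (eval v s) (eval v t)
  | TRDiv s t => op_apply (lrdiv Q) (eval v s) (eval v t)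
  end.

(* For U small enough both sides are always defined, by continuity. *)
Definition satisfies (R : realType) (Q : local_loop R) (i : loop_identity) :
    Prop :=
  exists2 U : set Q, nbhs (lone Q) U &
    forall v : nat -> Q, (forall k, U (v k)) ->
      exists2 q : Q, eval v i.1 = Some q & eval v i.2 = Some q.

(* ((x y) x) z = x (y (x z)) *)
Definition moufang_identity : loop_identity :=
  let x := TVar 0 in let y := TVar 1 in let z := TVar 2 in
  (TMul (TMul (TMul x y) x) z, TMul x (TMul y (TMul x z))).

Definition local_moufang (R : realType) (Q : local_loop R) : Prop :=
  satisfies Q moufang_identity.

Definition defined_in (R : realType) (M : smooth_manifold R) (e : M)
    (U : set M) (o : local_op e) (x y : M) : Prop :=
  op_dom o (x, y) /\ U (o x y).

Definition closed_in (R : realType) (M : smooth_manifold R) (e : M)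
    (U : set M) (o : local_op e) (H : set M) : Prop :=
  forall x y, H x -> H y -> defined_in U o x y -> H (o x y).

Definition local_subloop (R : realType) (Q : local_loop R) (U H : set Q) :
    Prop :=
  [/\ H `<=` U, H (lone Q), closed_in U (lmul Q) H,
      closed_in U (lldiv Q) H & closed_in U (lrdiv Q) H].

Definition generated_subloop (R : realType) (Q : local_loop R) (U S : set Q) :
    set Q :=
  smallest (local_subloop U) S.

Definition is_local_group (R : realType) (Q : local_loop R) (U H : set Q) :
    Prop :=
  forall x y z, H x -> H y -> H z ->
    defined_in U (lmul Q) x y -> defined_in U (lmul Q) (lmul Q x y) z ->
    defined_in U (lmul Q) y z -> defined_in U (lmul Q) x (lmul Q y z) ->
    lmul Q (lmul Q x y) z = lmul Q x (lmul Q y z).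

(* A neighbourhood U with the property below can be replaced by any smaller
   one; the same holds in moufang_theorem_holds. *)
Definition diassociative (R : realType) (Q : local_loop R) : Prop :=
  exists2 U : set Q, nbhs (lone Q) U &
    forall a b : Q, U a -> U b ->
      is_local_group U (generated_subloop U [set a; b]).

(* [set (local_loop R)] would be a universe inconsistency. *)
Definition is_variety (R : realType) (W : local_loop R -> Prop) : Prop :=
  exists E : set loop_identity, forall Q : local_loop R,
    W Q <-> diassociative Q /\ forall i, E i -> satisfies Q i.

Definition associate (R : realType) (Q : local_loop R) (a b c : Q) : Prop :=
  [/\ op_dom (lmul Q) (a, b), op_dom (lmul Q) (lmul Q a b, c),
      op_dom (lmul Q) (b, c), op_dom (lmul Q) (a, lmul Q b c) &
      lmul Q (lmul Q a b) c = lmul Q a (lmul Q b c)].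

Definition moufang_theorem_holds (R : realType) (Q : local_loop R) : Prop :=
  exists2 U : set Q, nbhs (lone Q) U &
    forall a b c : Q, U a -> U b -> U c -> associate a b c ->
      is_local_group U (generated_subloop U [set a; b; c]).

(* Main.v *)
Require Import Defs.
From mathcomp Require Import all_boot all_order all_algebra.
From mathcomp Require Import all_classical all_reals all_analysis.
From mathcomp Require Import ring lra.
Import Order.TTheory GRing.Theory Num.Theory.
Import numFieldNormedType.Exports.

Set Implicit Arguments.
Unset Strict Implicit.
Unset Printing Implicit Defensive.

Local Open Scope classical_set_scope.
Local Open Scope ring_scope.

(** The variety is cut out by six identities on the associator
    [(x, y, z) = (x (y z)) \ ((x y) z)]. They hold in a nilpotent loop on R^6, an
    extension of the additive group R^3 by a unipotent module M of dimension 3 on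
    which only the third coordinate h of R^3, called height below, acts. Its
    associators lie in M and are
      [(u, v, w) = (0, D, D (h u + 2 h v + 3 h w))],  [D = det (u, v, w)],
    so they vanish exactly on linearly dependent triples of R^3. This loop is
    diassociative, but ((x y) x) z and x (y (x z)) differ by the nonzero polynomial
    D (h x + h y), up to sign, in the last coordinate. Its tangent algebra A is a
    binary Lie algebra with J(A, A, A A) = 0 in which J(x, y, z) x is not
    identically 0, so A is not a Malcev algebra.

    The identities record three properties of that formula: antisymmetry of D,
    [(x, x, y) = 1], and additivity of D in the middle argument under products and
    both divisions. The last coordinate obeys these laws only up to products of D
    and heights; those are visible in the loop, because conjugating an associator by
    v adds 4 D h v to its last coordinate. So each identity expresses a power of an associator, with exponent 1, 2
    or 4, through conjugates of other associators, and it forces that power to be 1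
    as soon as those other associators are 1.

    In a smooth loop the squaring map has derivative 2 at 1, so near 1 the
    equation x x = 1 gives x = 1 ([near_square_one]). Hence, close to the
    identity, the relation (x, y, z) = 1 is invariant under permutations, holds when two
    arguments are equal, and, for fixed x and y, the solutions w of (x, w, y) = 1 form a
    local subloop ([associates_closed]). If (a, b, c) = 1, then all triples of
    generators associate, and the subloop property carries this over to
    triples of generated elements, one argument at a time
    ([moufang_theorem_of_identities]). The case of a, a, b, whose associator is always
    1, is diassociativity; so the six identities alone define the variety. *)

(** * The local nature of identities *)

(** The filter of valuations all of whose values are close to 1: a statement that
    holds eventually along it holds for all elements of one neighbourhood,
    and filter lemmas take care of shrinking neighbourhoods. *)
Definition near_one (R : realType) (Q : local_loop R) : set_system (nat -> Q) :=
  [set P | exists2 U : set Q, nbhs (lone Q) U &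
    forall v : nat -> Q, (forall k, U (v k)) -> P v].

Arguments near_one {R} Q.

Global Instance near_one_filter (R : realType) (Q : local_loop R) :
  Filter (near_one Q).
Proof.
split=> [|A B [U nU UA] [V nV VB]|A B AB [U nU UA]].
- by exists setT => //; exact: filterT.
- exists (U `&` V); first exact: filterI.
  by move=> v UVv; split; [apply: UA|apply: VB] => k; have [] := UVv k.
- by exists U => // v /UA /AB.
Qed.

(** Evaluation by the underlying total functions. Where [eval] is defined the two
    agree, so no domain has to be tracked after [satisfies_teval]. *)
Fixpoint teval (R : realType) (Q : local_loop R) (v : nat -> Q)
    (t : loop_term) : Q :=
  match t with
  | TVar i => v i
  | TOne => lone Q
  | TMul s t => lmul Q (teval v s) (teval v t)
  | TLDiv s t => lldiv Q (teval v s) (teval v t)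
  | TRDiv s t => lrdiv Q (teval v s) (teval v t)
  end.

Lemma op_apply_Some (R : realType) (M : smooth_manifold R) (e : M)
    (o : local_op e) (x y : option M) (q : M) :
  op_apply o x y = Some q -> exists a b, [/\ x = Some a, y = Some b & q = o a b].
Proof.
case: x y => [a|] [b|] //=; rewrite /op_apply /=.
by case: ifP => // _ [<-]; exists a, b.
Qed.

Lemma eval_teval (R : realType) (Q : local_loop R) (v : nat -> Q) t q :
  Defs.eval v t = Some q -> teval v t = q.
Proof.
elim: t q => [i|| s IHs t IHt | s IHs t IHt | s IHs t IHt] q /=;
  try by case.
all: by move=> /op_apply_Some [a [b [/IHs -> /IHt -> ->]]].
Qed.

Lemma satisfies_teval (R : realType) (Q : local_loop R) i : satisfies Q i ->
  \forall v \near near_one Q, teval v i.1 = teval v i.2.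
Proof.
move=> [U nU Ui]; exists U => // v /Ui [q].
by move=> /eval_teval -> /eval_teval ->.
Qed.

Section LocalLoop.
Variables (R : realType) (Q : local_loop R).
Local Notation one := (lone Q).
Local Notation m := (lmul Q).
Local Notation l := (lldiv Q).
Local Notation r := (lrdiv Q).
Implicit Types (t : loop_term) (v : nat -> Q).

Lemma mul11 : m one one = one.
Proof. exact: (nbhs_singleton (lmulx1 Q)). Qed.

Lemma ldiv11 : l one one = one.
Proof. by have := nbhs_singleton (lmulKldiv Q); rewrite /= mul11. Qed.

Lemma rdiv11 : r one one = one.
Proof. by have := nbhs_singleton (lmulKrdiv Q); rewrite /= mul11. Qed.

Lemma near_one_var (V : set Q) i : nbhs one V ->
  \forall v \near near_one Q, V (v i).
Proof. by move=> nV; exists V. Qed.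

Lemma near_one_op (o : local_op one) (s t : loop_term) (V : set Q) :
  o one one = one ->
  (forall V : set Q, nbhs one V -> \forall v \near near_one Q, V (teval v s)) ->
  (forall V : set Q, nbhs one V -> \forall v \near near_one Q, V (teval v t)) ->
  nbhs one V -> \forall v \near near_one Q, V (o (teval v s) (teval v t)).
Proof.
move=> o11 Hs Ht nV.
have [entry _] := op_smooth o.
have /entry : (one, one) \in op_dom o by rewrite inE; exact: op_dom_one.
move=> /(_ V); rewrite /= o11 => /(_ nV) [[A B] [/= nA nB] AB].
apply: filterS2 (Hs _ nA) (Ht _ nB) => v Av Bv.
by apply: (AB (teval v s, teval v t)).
Qed.

(** Every term takes the value 1 when its variables do, and terms are continuous. *)
Lemma near_one_teval (V : set Q) t : nbhs one V ->
  \forall v \near near_one Q, V (teval v t).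
Proof.
elim: t V => [i|| s IHs t IHt | s IHs t IHt | s IHs t IHt] V nV /=.
- exact: near_one_var.
- by apply: filterE => v; exact: nbhs_singleton.
- exact: (near_one_op mul11).
- exact: (near_one_op ldiv11).
- exact: (near_one_op rdiv11).
Qed.

Definition tsubst (ts : seq loop_term) v : nat -> Q :=
  fun k => teval v (nth TOne ts k).

(** Local statements may be instantiated at terms; variables beyond those of the
    list are sent to 1. *)
Lemma near_one_subst (P : (nat -> Q) -> Prop) (ts : seq loop_term) :
  (\forall v \near near_one Q, P v) ->
  \forall v \near near_one Q, P (tsubst ts v).
Proof.
move=> [U nU UP]; rewrite /tsubst.
have H : \forall v \near near_one Q, forall k, U (teval v (nth TOne ts k)).
  elim: ts => [|t ts IH].
    by apply: filterE => v k; rewrite nth_nil /=; exact: nbhs_singleton.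
  by apply: filterS2 (near_one_teval t nU) IH => v Ut Uts [|k] //=.
by apply: filterS H => v; exact: UP.
Qed.

Lemma near_one_pair (P : Q * Q -> Prop) : (\forall p \near (one, one), P p) ->
  \forall v \near near_one Q, P (v 0%N, v 1%N).
Proof.
move=> [[A B] [/= nA nB] AB].
apply: filterS2 (near_one_var 0 nA) (near_one_var 1 nB) => v Av Bv.
exact: (AB (v 0%N, v 1%N)).
Qed.
End LocalLoop.

(** * Squares near the identity *)

Lemma mean_value_bound (R : realType) (f df : R -> R) (a b c e : R) :
  (forall x, Num.min a b <= x <= Num.max a b ->
    is_derive x 1 f (df x) /\ `|df x - c| <= e) ->
  `|f b - f a - (b - a) * c| <= e * `|b - a|.
Proof.
wlog ab : a b / a <= b => [H|].
  have /orP[ab|ba] := le_total a b; first exact: H.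
  move=> fab; have := H _ _ ba; rewrite minC maxC => /(_ fab).
  have -> : f b - f a - (b - a) * c = - (f a - f b - (a - b) * c) by ring.
  by rewrite normrN (distrC b).
rewrite (min_idPl ab) (max_idPr ab) => fab.
have [||x xab ->] := @MVT_segment R f df a b ab.
- by move=> x /andP[/ltW ax /ltW xb]; exact: (fab x (introT andP (conj ax xb))).1.
- apply: derivable_within_continuous => x xab.
  by have [d _] := fab x xab; exact: ex_derive.
- by rewrite (mulrC (b - a)) -mulrBl normrM ler_wpM2r // (fab x xab).2.
Qed.

(** A directional derivative is an ordinary derivative along a line, which makes
    the one-variable mean value theorem applicable. *)
Lemma is_derive_line (R : numFieldType) (V W : normedModType R) (F : V -> W)
    (a v : V) (s : R) : derivable F (a + s *: v) v ->
  is_derive s (1 : R) (fun t : R => F (a + t *: v)) ('D_v F (a + s *: v)).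
Proof.
pose G := fun t : R => F (a + t *: v).
have E : (fun h : R => h^-1 *: ((F \o shift (a + s *: v)) (h *: v) - F (a + s *: v))) =
         (fun h : R => h^-1 *: ((G \o shift s) (h *: 1) - G s)).
  apply/funext => h; rewrite /G /=; congr (_ *: (F _ - _)).
  by rewrite [h *: 1]mulr1 scalerDl addrCA.
rewrite /derivable E => dF; split => //.
by rewrite /derive E.
Qed.

Lemma coord_le_norm (R : realType) n (x : 'rV[R]_n) i : `|x 0 i| <= `|x|.
Proof. by rewrite [leRHS]/Num.Def.normr /= mx_normrE; exact: (le_bigmax _ _ (0, i)). Qed.

Lemma norm_le_coord (R : realType) n (x : 'rV[R]_n) (e : R) : 0 <= e ->
  (forall i, `|x 0 i| <= e) -> `|x| <= e.
Proof.
move=> e0 xe; rewrite [leLHS]/Num.Def.normr /= mx_normrE; apply: bigmax_le => // -[i j] _ /=.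
by rewrite (ord1 i).
Qed.

(** Since F(u, e) = u, the difference F(u, u) - u is the increment of F(u, .) from e
    to u. Changing the second argument one coordinate at a time, the mean value
    theorem compares this increment with u - e, because the partial
    derivatives are continuous and equal to those of the identity at (e, e). If
    F(u, u) = e, then 2 (u - e) is bounded by a fraction of the norm of u - e. *)
Lemma mul_unit_square_chart (R : realType) n
    (F : 'rV[R]_n * 'rV[R]_n -> 'rV[R]_n) A (e : 'rV[R]_n) :
  nbhs (e, e) A -> Ck_on 1 A F ->
  (\forall u \near e, F (u, e) = u) -> (\forall u \near e, F (e, u) = u) ->
  \forall u \near e, F (u, u) = e -> u = e.
Proof.
move=> nA [_ F1] Fr Fl.
pose w (j : 'I_n) : 'rV[R]_n * 'rV[R]_n := (0, delta_mx 0 j).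
have dF (j : 'I_n) p : A p -> derivable F p (w j) by exact: (F1 (w j)).1.
have Dw (j : 'I_n) : 'D_(w j) F (e, e) = delta_mx 0 j.
  have := @is_derive_line R _ _ F (e, e) (w j) 0.
  rewrite scale0r addr0 => /(_ (dF _ _ (nbhs_singleton nA))) [_ <-].
  have Hnear : \forall t \near (0 : R), F ((e, e) + t *: w j) = e + t *: delta_mx 0 j.
    have : {for 0, continuous (fun t : R => e + t *: (delta_mx 0 j : 'rV[R]_n))}.
      apply: (@continuousD _ _ _ (cst e)); first exact: cst_continuous.
      exact: scalel_continuous.
    have nF : nbhs (e + 0 *: (delta_mx 0 j : 'rV[R]_n)) (fun u => F (e, u) = u).
      by rewrite scale0r addr0.
    move=> /(_ _ nF) H.
    have {}H : \forall t \near (0 : R),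
      F (e, e + t *: (delta_mx 0 j : 'rV[R]_n)) = e + t *: delta_mx 0 j by exact: H.
    apply: filterS H => t /= <-; congr (F _).
    by rewrite /w; congr pair; rewrite /= ?scaler0 ?addr0.
  rewrite (near_eq_derive _ Hnear).
  have := @is_derive_line R _ _ id e (delta_mx 0 j) 0 (@derivable_id _ _ _ _).
  by case=> _ ->; rewrite derive_id.
(* the errors of the n coordinate steps add up to at most the norm of u - e *)
pose eps : R := n.+1%:R^-1.
have eps0 : 0 < eps by rewrite invr_gt0 ltr0n.
have nG : \forall p \near (e, e), A p /\
    forall i j : 'I_n, `|('D_(w j) F p) 0 i - (delta_mx 0 j : 'rV[R]_n) 0 i| <= eps.
  have FF : Filter (nbhs (e, e)) by exact: nbhs_filter.
  suff G : forall i j : 'I_n, \forall p \near (e, e),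
      `|('D_(w j) F p) 0 i - (delta_mx 0 j : 'rV[R]_n) 0 i| <= eps.
    have G' : \forall p \near (e, e), forall i j : 'I_n,
        `|('D_(w j) F p) 0 i - (delta_mx 0 j : 'rV[R]_n) 0 i| <= eps.
      apply: (@filter_forall _ 'I_n _ (nbhs (e, e)) FF) => i.
      by apply: (@filter_forall _ 'I_n _ (nbhs (e, e)) FF) => j; exact: G.
    by apply: filterS2 nA G' => p Ap Gp; split.
  move=> i j.
  have cD : {for (e, e), continuous ('D_(w j) F)}.
    have [_ [cD _]] := F1 (w j); apply: cD.
    by rewrite inE; exact: nbhs_singleton.
  have := @continuous_comp _ _ _ _ (fun x : 'rV[R]_n => x 0 i) _ cD (@coord_continuous _ _ _ _ _ _).
  move=> /cvgrPdist_le /(_ _ eps0); rewrite /= Dw; apply: filterS => p.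
  by rewrite distrC.
have [d /= d0 dP] := (nbhs_ballP _ _).1 nG.
have {}dP x y : ball e d x -> ball e d y -> A (x, y) /\
    forall i j : 'I_n, `|('D_(w j) F (x, y)) 0 i - (delta_mx 0 j : 'rV[R]_n) 0 i| <= eps.
  by move=> ex ey; apply: dP.
apply: filterS2 (nbhsx_ballx e _ d0) Fr => u ud Fu Fuu.
pose p k : 'rV[R]_n := \row_j (if (j < k)%N then u 0 j else e 0 j).
have step (k i : 'I_n) : `|F (u, p k.+1) 0 i - F (u, p k) 0 i -
    (u 0 k - e 0 k) * (delta_mx 0 k : 'rV[R]_n) 0 i| <= eps * `|u 0 k - e 0 k|.
  (* p k and p k.+1 lie on the line through (u, q) in the direction of the kth
     coordinate, at the parameters e_k and u_k *)
  pose q : 'rV[R]_n := \row_j (if j == k then 0 else p k 0 j).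
  have Eq t : (u, q) + t *: w k =
      (u, \row_j (if j == k then t else p k 0 j)) :> 'rV[R]_n * 'rV[R]_n.
    congr pair; rewrite /= ?scaler0 ?addr0 //.
    by apply/rowP => j; rewrite !mxE eqxx /=; case: eqP => _; rewrite ?mulr1 ?mulr0 ?add0r ?addr0.
  have Ee : p k = \row_j (if j == k then e 0 k else p k 0 j).
    by apply/rowP => j; rewrite !mxE; case: eqP => // ->; rewrite ltnn.
  have Eu : p k.+1 = \row_j (if j == k then u 0 k else p k 0 j).
    apply/rowP => j; rewrite !mxE ltnS leq_eqVlt.
    have [->|jk] := eqVneq j k; first by rewrite eqxx.
    by rewrite (_ : (j == k :> nat) = false) //; exact/negbTE.
  have Fe : F (u, p k) = F ((u, q) + e 0 k *: w k) by rewrite Eq -Ee.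
  have Fu' : F (u, p k.+1) = F ((u, q) + u 0 k *: w k) by rewrite Eq -Eu.
  rewrite Fe Fu'.
  apply: (@mean_value_bound _ (fun t => F ((u, q) + t *: w k) 0 i)
    (fun t => ('D_(w k) F ((u, q) + t *: w k)) 0 i)) => t tk.
  have [At gt] : A ((u, q) + t *: w k) /\
      forall i j : 'I_n, `|('D_(w j) F ((u, q) + t *: w k)) 0 i -
        (delta_mx 0 j : 'rV[R]_n) 0 i| <= eps.
    rewrite Eq; apply: dP => //.
    case: ud => _ ud; split => // i0 j; rewrite ord1 !mxE.
    case: eqP => [->|_]; last by case: ifP => _; [exact: ud|exact: ballxx].
    have := ud 0 k; rewrite /ball /= => udk.
    apply: le_lt_trans udk; move: tk.
    have [ue|/ltW ue] := leP (e 0 k) (u 0 k) => /andP[t1 t2].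
      by rewrite distrC (distrC (e 0 k)) !ger0_norm ?subr_ge0 // lerD2r.
    by rewrite !ger0_norm ?subr_ge0 // lerD2l lerN2.
  split; last exact: gt.
  have dFt := dF k _ At.
  have -> : ('D_(w k) F ((u, q) + t *: w k)) 0 i =
      'D_(w k) (fun p => F p 0 i) ((u, q) + t *: w k).
    by rewrite (derive_mx dFt) mxE.
  move/derivable_mxP : dFt => dFt.
  exact: (@is_derive_line R _ _ (fun p => F p 0 i)).
have E i : `|F (u, u) 0 i - u 0 i - (u 0 i - e 0 i)| <= n%:R * eps * `|u - e|.
  have -> : F (u, u) 0 i - u 0 i = \sum_(k < n) (F (u, p k.+1) 0 i - F (u, p k) 0 i).
    rewrite -(big_mkord xpredT (fun k => F (u, p k.+1) 0 i - F (u, p k) 0 i)).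
    rewrite telescope_sumr //; congr (_ - _).
      by congr (F (u, _) _ _); apply/rowP => j; rewrite !mxE ltn_ord.
    by rewrite -[in LHS]Fu; congr (F (u, _) _ _); apply/rowP => j; rewrite !mxE.
  have -> : u 0 i - e 0 i = \sum_(k < n) (u 0 k - e 0 k) * (delta_mx 0 k : 'rV[R]_n) 0 i.
    rewrite (bigD1 i) //= mxE !eqxx mulr1 big1 ?addr0 // => k ki.
    by rewrite mxE eqxx eq_sym (negPf ki) mulr0.
  rewrite -sumrB; apply: le_trans (ler_norm_sum _ _ _) _.
  have <- : \sum_(k < n) (eps * `|u - e|) = n%:R * eps * `|u - e|.
    by rewrite sumr_const card_ord -mulrA mulr_natl.
  apply: ler_sum => k _; apply: le_trans (step k i) _.
  apply: ler_wpM2l; first exact: ltW.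
  by have := coord_le_norm (u - e) k; rewrite [(u - e) 0 k]mxE [(- e) 0 k]mxE.
apply/eqP; rewrite -subr_eq0 -normr_le0.
have neps : n%:R * eps <= 1.
  by rewrite ler_pdivrMr ?ltr0n // mul1r ler_nat.
have : `|u - e| <= `|u - e| / 2.
  apply: norm_le_coord => [|i]; first by rewrite divr_ge0.
  rewrite ler_pdivlMr // !mxE.
  have := E i; rewrite Fuu.
  have -> : e 0 i - u 0 i - (u 0 i - e 0 i) = - ((u 0 i - e 0 i) * 2) by ring.
  rewrite normrN normrM (ger0_norm (x := 2)) // => /le_trans; apply.
  by rewrite -[leRHS]mul1r ler_wpM2r.
rewrite ler_pdivlMr //; have := normr_ge0 (u - e); lra.
Qed.

Lemma near_square_one (R : realType) (Q : local_loop R) :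
  \forall x \near lone Q, lmul Q x x = lone Q -> x = lone Q.
Proof.
have [c ac ce] := atlas_cover (lone Q).
set m := lmul Q; set one := lone Q; pose e := chart_to c one.
have to_from : {in chart_dom c, cancel (chart_to c) (chart_from c)} by exact: chart_toK.
have fromE : chart_from c e = one by rewrite to_from // inE.
have e_im : chart_im c e by exists one.
have to_cont : chart_to c x @[x --> one] --> e.
  by apply: chart_to_continuous; rewrite inE.
have from_cont : chart_from c u @[u --> e] --> one.
  by rewrite -fromE; apply: chart_from_continuous; rewrite inE.
have n_im : nbhs e (chart_im c).
  by apply: open_nbhs_nbhs; split; [exact: chart_im_open|exact: e_im].
have n_dom : nbhs one (chart_dom c).
  by apply: open_nbhs_nbhs; split; [exact: chart_dom_open|exact: ce].
have [mcont /(_ c c c ac ac ac) /(_ 1%N) msm] := op_smooth m.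
have m11 := mul11 Q.
pose F (u : 'rV[R]_(manifold_dim Q) * 'rV[R]_(manifold_dim Q)) :=
  chart_to c (m (chart_from c u.1) (chart_from c u.2)).
have from2 : (chart_from c u.1, chart_from c u.2) @[u --> (e, e)] --> (one, one).
  by apply: cvg_pair => /=; apply: cvg_comp from_cont; [exact: cvg_fst|exact: cvg_snd].
have n_opdom : nbhs (one, one) (op_dom m).
  apply: open_nbhs_nbhs; split; [exact: op_dom_open|exact: op_dom_one].
have m_cvg : (fun p : Q * Q => m p.1 p.2) @ (one, one) --> one.
  have /mcont : (one, one) \in op_dom m by rewrite inE; exact: op_dom_one.
  by rewrite /prop_for /continuous_at /= m11.
move: msm; set A := [set u | _] => msm.
have nA : nbhs (e, e) A.
  have H1 : \forall u \near (e, e), chart_im c u.1 by exact: cvg_fst n_im.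
  have H2 : \forall u \near (e, e), chart_im c u.2 by exact: cvg_snd n_im.
  have H3 := from2 _ n_opdom.
  have H4 := from2 _ (m_cvg _ n_dom).
  by apply: filterS3 H1 H2 (filterI H3 H4) => u u1 u2 [u3 u4]; split.
have from_dom u : chart_im c u -> chart_dom c (chart_from c u) /\ chart_to c (chart_from c u) = u.
  by move=> [x cx <-]; rewrite to_from ?inE.
have H1 : \forall u \near e, F (u, e) = u.
  apply: filterS2 n_im (from_cont _ (lmulx1 Q)) => u /from_dom[_ uK] /= E.
  by rewrite /F /= fromE E.
have H2 : \forall u \near e, F (e, u) = u.
  apply: filterS2 n_im (from_cont _ (lmul1x Q)) => u /from_dom[_ uK] /= E.
  by rewrite /F /= fromE E.
have /to_cont := mul_unit_square_chart nA msm H1 H2.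
apply: filterS2 n_dom => x cx /= Fx xx.
have xK : chart_from c (chart_to c x) = x by rewrite to_from // inE.
by rewrite -xK Fx ?fromE // /F /= xK xx.
Qed.

(** * The identities and the Moufang theorem *)

Definition assoc_term s t u := TLDiv (TMul s (TMul t u)) (TMul (TMul s t) u).
Definition conj_term k s := TLDiv s (TMul k s).
Definition conjV_term k s := TRDiv (TMul s k) s.
Definition sq_term s := TMul s s.
Definition pow4_term s := sq_term (sq_term s).

Local Notation X := (TVar 0).
Local Notation Y := (TVar 1).
Local Notation Z := (TVar 2).
Local Notation T := (TVar 3).

(** In the next two identities both sides are products of associators and their
    conjugates. With k = (x, y, z) and in the additive notation of the module M, the first
    one reads 4 (y, x, z) = k^y - k^x - 4 k. *)
Definition swap12_identity : loop_identity :=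
  let k := assoc_term X Y Z in
  (TMul (pow4_term (assoc_term Y X Z)) (TMul (conj_term k X) (pow4_term k)),
   conj_term k Y).

Definition swap23_identity : loop_identity :=
  let k := assoc_term X Y Z in
  (TMul (pow4_term (assoc_term X Z Y)) (TMul (conj_term k Y) (pow4_term k)),
   conj_term k Z).

Definition alternative_identity : loop_identity := (assoc_term X X Y, TOne).

(** Additivity of the determinant in the middle argument. With D and D' the
    determinants of (x, z, y) and (x, t, y), doubling (x, z t, y) produces the mixed
    terms 4 (D h t + D' h z), exactly what conjugation by t and by z adds. The
    other two arguments would produce weights 1 and 3 instead of 2, and need a higher
    power. *)
Definition mul_identity : loop_identity :=
  let k := assoc_term X Z Y in let k' := assoc_term X T Y in
  (sq_term (assoc_term X (TMul Z T) Y),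
   TMul (TMul k (conj_term k T)) (TMul k' (conj_term k' Z))).

(** The same computation as for products, with all terms of negative sign moved to
    the other side; in R^3 the class of z \ t is t - z. *)
Definition ldiv_identity : loop_identity :=
  let k := assoc_term X Z Y in let k' := assoc_term X T Y in
  (TMul (sq_term (assoc_term X (TLDiv Z T) Y))
        (TMul (conjV_term k Z) (conj_term k (TLDiv Z T))),
   TMul k' (conjV_term k' Z)).

(** In the model the associator depends only on classes in R^3, where both quotients
    are t - z. *)
Definition rdiv_identity : loop_identity :=
  (assoc_term X (TRDiv T Z) Y, assoc_term X (TLDiv Z T) Y).

Definition associator_identities : set loop_identity :=
  [set i | i = swap12_identity \/ i = swap23_identity \/
    i = alternative_identity \/ i = mul_identity \/ i = ldiv_identity \/
    i = rdiv_identity].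

Section Moufang.
Variables (R : realType) (Q : local_loop R).
Hypothesis QE : forall i, associator_identities i -> satisfies Q i.
Local Notation one := (lone Q).
Local Notation m := (lmul Q).
Local Notation l := (lldiv Q).
Local Notation r := (lrdiv Q).
Implicit Types (s t u : loop_term) (v : nat -> Q).

Definition associates (x y z : Q) := m (m x y) z = m x (m y z).

Lemma near_assocP s t u : \forall v \near near_one Q,
  teval v (assoc_term s t u) = one <->
  associates (teval v s) (teval v t) (teval v u).
Proof.
pose p := TMul s (TMul t u); pose q := TMul (TMul s t) u.
have H1 := near_one_subst [:: p; q] (near_one_pair (lldivKmul Q)).
have H2 := near_one_subst [:: p; TOne] (near_one_pair (lmulKldiv Q)).
have H3 := near_one_teval p (lmulx1 Q).
apply: filterS3 H1 H2 H3 => v; rewrite /tsubst /= => {}H1 {}H2 {}H3.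
rewrite /associates; split=> [E|->]; first by rewrite -H1 E H3.
by rewrite -[X in l _ X]H3.
Qed.

Lemma near_conj_one s : \forall v \near near_one Q,
  l (teval v s) (m one (teval v s)) = one /\
  r (m (teval v s) one) (teval v s) = one.
Proof.
have H1 := near_one_subst [:: s; TOne] (near_one_pair (lmulKldiv Q)).
have H2 := near_one_subst [:: TOne; s] (near_one_pair (lmulKrdiv Q)).
have H3 := near_one_teval s (lmulx1 Q).
have H4 := near_one_teval s (lmul1x Q).
apply: (filter_app _ _ H1); apply: (filter_app _ _ H2).
apply: filterS2 H3 H4 => v; rewrite /tsubst /= => {}H3 {}H4 {}H2 {}H1; split.
  by rewrite H4 -[X in l _ X]H3.
by rewrite H3 -[X in r X _]H4.
Qed.

Lemma near_square_term t : \forall v \near near_one Q,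
  m (teval v t) (teval v t) = one -> teval v t = one.
Proof. exact: (near_one_teval t (@near_square_one R Q)). Qed.

Lemma near_pow4_term t : \forall v \near near_one Q,
  teval v (pow4_term t) = one -> teval v t = one.
Proof.
apply: filterS2 (near_square_term t) (near_square_term (sq_term t)) => v.
by move=> H1 H2 /= /H2 /H1.
Qed.

Lemma near_identity i : associator_identities i ->
  \forall v \near near_one Q, teval v i.1 = teval v i.2.
Proof. by move/QE/satisfies_teval. Qed.

Local Ltac use_identity i :=
  have I := near_identity (i := i)
    ltac:(rewrite /associator_identities /mkset; tauto).

Lemma near_alternative : \forall v \near near_one Q,
  associates (v 0%N) (v 0%N) (v 1%N).
Proof.
use_identity alternative_identity.
by apply: filterS2 I (near_assocP X X Y) => v I [P _]; exact: P.
Qed.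

Lemma near_swap12 : \forall v \near near_one Q,
  associates (v 0%N) (v 1%N) (v 2%N) -> associates (v 1%N) (v 0%N) (v 2%N).
Proof.
pose t := assoc_term Y X Z.
use_identity swap12_identity.
have U := near_one_teval (pow4_term t) (lmulx1 Q).
apply: (filter_app _ _ (near_assocP X Y Z)).
apply: (filter_app _ _ (near_assocP Y X Z)).
apply: (filter_app _ _ (near_pow4_term t)).
apply: (filter_app _ _ I); apply: (filter_app _ _ U).
apply: filterS2 (near_conj_one X) (near_conj_one Y).
move=> v [C0 _] [C1 _] {}U {}I P4 [A213 _] [_ A123] /A123 E.
apply/A213/P4; rewrite -U; move: I => /=; move: E => /= ->.
by rewrite C0 C1 !mul11.
Qed.

Lemma near_swap23 : \forall v \near near_one Q,
  associates (v 0%N) (v 1%N) (v 2%N) -> associates (v 0%N) (v 2%N) (v 1%N).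
Proof.
pose t := assoc_term X Z Y.
use_identity swap23_identity.
have U := near_one_teval (pow4_term t) (lmulx1 Q).
apply: (filter_app _ _ (near_assocP X Y Z)).
apply: (filter_app _ _ (near_assocP X Z Y)).
apply: (filter_app _ _ (near_pow4_term t)).
apply: (filter_app _ _ I); apply: (filter_app _ _ U).
apply: filterS2 (near_conj_one Y) (near_conj_one Z).
move=> v [C1 _] [C2 _] {}U {}I P4 [A132 _] [_ A123] /A123 E.
apply/A132/P4; rewrite -U; move: I => /=; move: E => /= ->.
by rewrite C1 C2 !mul11.
Qed.

Lemma near_associates_mul : \forall v \near near_one Q,
  associates (v 0%N) (v 2%N) (v 1%N) -> associates (v 0%N) (v 3%N) (v 1%N) ->
  associates (v 0%N) (m (v 2%N) (v 3%N)) (v 1%N).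
Proof.
pose t := assoc_term X (TMul Z T) Y.
use_identity mul_identity.
apply: (filter_app _ _ (near_assocP X Z Y)).
apply: (filter_app _ _ (near_assocP X T Y)).
apply: (filter_app _ _ (near_assocP X (TMul Z T) Y)).
apply: (filter_app _ _ (near_square_term t)).
apply: (filter_app _ _ I).
apply: filterS2 (near_conj_one Z) (near_conj_one T).
move=> v [C2 _] [C3 _] {}I P2 [At _] [_ A3] [_ A2] /A2 E2 /A3 E3.
apply/At/P2; move: I => /= ->; move: E2 E3 => /= -> ->.
by rewrite C2 C3 !mul11.
Qed.

Lemma near_ldiv_associator : \forall v \near near_one Q,
  associates (v 0%N) (v 2%N) (v 1%N) -> associates (v 0%N) (v 3%N) (v 1%N) ->
  teval v (assoc_term X (TLDiv Z T) Y) = one.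
Proof.
pose t := assoc_term X (TLDiv Z T) Y.
use_identity ldiv_identity.
have U := near_one_teval (sq_term t) (lmulx1 Q).
apply: (filter_app _ _ (near_assocP X Z Y)).
apply: (filter_app _ _ (near_assocP X T Y)).
apply: (filter_app _ _ (near_square_term t)).
apply: (filter_app _ _ I); apply: (filter_app _ _ U).
apply: filterS2 (near_conj_one Z) (near_conj_one (TLDiv Z T)).
move=> v [_ C2] [C _] {}U {}I P2 [_ A3] [_ A2] /A2 E2 /A3 E3.
apply: P2; rewrite -[LHS]U; move: I => /=; move: E2 E3 => /= -> ->.
by move: C => /= ->; rewrite C2 !mul11.
Qed.

Lemma near_associates_div : \forall v \near near_one Q,
  associates (v 0%N) (v 2%N) (v 1%N) -> associates (v 0%N) (v 3%N) (v 1%N) ->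
  associates (v 0%N) (l (v 2%N) (v 3%N)) (v 1%N) /\
  associates (v 0%N) (r (v 3%N) (v 2%N)) (v 1%N).
Proof.
use_identity rdiv_identity.
apply: (filter_app _ _ (near_assocP X (TLDiv Z T) Y)).
apply: (filter_app _ _ (near_assocP X (TRDiv T Z) Y)).
apply: filterS2 near_ldiv_associator I => v E {}I [Ar _] [Al _] E2 E3.
by split; [apply/Al/E|apply/Ar; rewrite [LHS]I; apply: E].
Qed.

(** Local subloops of U are closed under the operations only as far as the results
    stay in U, so the closure laws have to hold for all elements of the same U in which
    the subloop is taken. *)
Lemma associates_closed : exists2 U : set Q, nbhs one U &
  [/\ forall x y z, U x -> U y -> U z ->
        associates x y z -> associates y x z /\ associates x z y,
      forall x y, U x -> U y -> associates x x y &
      forall x y, U x -> U y ->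
        local_subloop U [set z | U z /\ associates x z y]].
Proof.
have [U nU UP] : \forall v \near near_one Q,
  [/\ associates (v 0%N) (v 1%N) (v 2%N) -> associates (v 1%N) (v 0%N) (v 2%N)
        /\ associates (v 0%N) (v 2%N) (v 1%N),
      associates (v 0%N) (v 0%N) (v 1%N),
      associates (v 0%N) one (v 1%N),
      associates (v 0%N) (v 2%N) (v 1%N) -> associates (v 0%N) (v 3%N) (v 1%N) ->
      associates (v 0%N) (m (v 2%N) (v 3%N)) (v 1%N) &
      associates (v 0%N) (v 2%N) (v 1%N) -> associates (v 0%N) (v 3%N) (v 1%N) ->
      associates (v 0%N) (l (v 2%N) (v 3%N)) (v 1%N) /\
      associates (v 0%N) (r (v 3%N) (v 2%N)) (v 1%N)].
  apply: (filter_app _ _ near_swap12); apply: (filter_app _ _ near_swap23).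
  apply: (filter_app _ _ near_alternative).
  apply: (filter_app _ _ near_associates_mul).
  apply: (filter_app _ _ near_associates_div).
  apply: filterS2 (near_one_var 0 (lmulx1 Q)) (near_one_var 1 (lmul1x Q)).
  move=> v U0 U1 Cd Cm Alt S23 S12; split=> //.
    by move=> E; split; [exact: S12|exact: S23].
  by rewrite /associates /= U0 U1.
pose e (x y z w : Q) := nth one [:: x; y; z; w].
have Ue x y z w : U x -> U y -> U z -> U w -> forall k, U (e x y z w k).
  move=> Ux Uy Uz Uw [|[|[|[|k]]]] //=.
  by rewrite /e /= nth_nil; exact: nbhs_singleton.
exists U => //; split.
- by move=> x y z Ux Uy Uz; have [] := UP _ (Ue x y z x Ux Uy Uz Ux).
- by move=> x y Ux Uy; have [] := UP _ (Ue x y x x Ux Uy Ux Ux).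
move=> x y Ux Uy; split.
- by move=> z [].
- split; first exact: nbhs_singleton.
  by have [] := UP _ (Ue x y x x Ux Uy Ux Ux).
- move=> z w [Uz Hz] [Uw Hw] [_ Um]; split => //.
  by have [_ _ _ /(_ Hz Hw)] := UP _ (Ue x y z w Ux Uy Uz Uw).
- move=> z w [Uz Hz] [Uw Hw] [_ Um]; split => //.
  by have [_ _ _ _ /(_ Hz Hw)[]] := UP _ (Ue x y z w Ux Uy Uz Uw).
- move=> z w [Uz Hz] [Uw Hw] [_ Um]; split => //.
  by have [_ _ _ _ /(_ Hw Hz)[]] := UP _ (Ue x y w z Ux Uy Uw Uz).
Qed.

(** The first part of the conclusion lets the second one apply to a, a, b, which gives
    diassociativity on the same neighbourhood. *)
Lemma moufang_theorem_of_identities : exists2 U : set Q, nbhs one U &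
  (forall a b, U a -> U b -> associates a a b) /\
  (forall a b c, U a -> U b -> U c -> associates a b c ->
    is_local_group U (generated_subloop U [set a; b; c])).
Proof.
have [U nU [S A C]] := associates_closed.
exists U => //; split=> // a b c Ua Ub Uc abc.
set G := [set a; b; c]; set H := generated_subloop U G.
have UG : G `<=` U by move=> x [[->|->]|->].
have GH : G `<=` H by move=> x Gx K [_]; apply.
(* the subloop of middle arguments contains H as soon as it contains the generators *)
have Hmin x y : U x -> U y -> (forall z, G z -> associates x z y) ->
    forall z, H z -> associates x z y.
  move=> Ux Uy xGy z Hz.
  have /Hz [] // : [set K | local_subloop U K /\ G `<=` K]
      [set z | U z /\ associates x z y].
  by split; [exact: C|move=> w Gw; split; [exact: UG|exact: xGy]].
have HU : H `<=` U.
  move=> x Hx; have /Hx [] // : [set K | local_subloop U K /\ G `<=` K]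
      [set z | U z /\ associates a z a].
  split; first exact: C.
  move=> w Gw; split; first exact: UG.
  by apply: (S _ _ _ _ _ _ (A a w _ _)).2 => //; exact: UG.
have S12 x y z : U x -> U y -> U z -> associates x y z -> associates y x z.
  by move=> Ux Uy Uz /(S _ _ _ Ux Uy Uz)[].
have S23 x y z : U x -> U y -> U z -> associates x y z -> associates x z y.
  by move=> Ux Uy Uz /(S _ _ _ Ux Uy Uz)[].
(* in a triple with a repeated generator, permutations reduce to associates x x y *)
have GGG x y z : G x -> G y -> G z -> associates x y z.
  have Axyx x' y' : U x' -> U y' -> associates x' y' x'.
    by move=> Ux Uy; apply: S23 => //; exact: A.
  have Axyy x' y' : U x' -> U y' -> associates x' y' y'.
    by move=> Ux Uy; apply: S12 => //; exact: Axyx.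
  have bac := S12 _ _ _ Ua Ub Uc abc; have acb := S23 _ _ _ Ua Ub Uc abc.
  have bca := S23 _ _ _ Ub Ua Uc bac; have cab := S12 _ _ _ Ua Uc Ub acb.
  have cba := S12 _ _ _ Ub Uc Ua bca.
  by move=> [[->|->]|->] [[->|->]|->] [[->|->]|->] //;
    first [exact: A|exact: Axyx|exact: Axyy].
have GGH x y z : G x -> G y -> H z -> associates x y z.
  move=> Gx Gy Hz; have [[Ux Uy] Uz] := (UG _ Gx, UG _ Gy, HU _ Hz).
  apply: S23 => //; move: z Hz {Uz}; apply: Hmin => // z Gz.
  exact: GGG.
have GHH x y z : G x -> H y -> H z -> associates x y z.
  move=> Gx Hy Hz; have [[Ux Uy] Uz] := (UG _ Gx, HU _ Hy, HU _ Hz).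
  by move: y Hy {Uy}; apply: Hmin => // y Gy; exact: GGH.
move=> x y z Hx Hy Hz _ _ _ _.
have [[Ux Uy] Uz] := (HU _ Hx, HU _ Hy, HU _ Hz).
apply: (S12 _ _ _ Uy Ux Uz).
move: x Hx {Ux}; apply: Hmin => // x Gx.
by apply: S12 => //; [exact: UG|exact: GHH].
Qed.

End Moufang.

(** * Polynomial maps are smooth *)

Lemma Ck_on_le (R : realType) (V W : normedModType R) k (A : set V)
    (f : V -> W) : Ck_on k.+1 A f -> Ck_on k A f.
Proof.
elim: k f => [|k IH] f [cf df]; split => // v.
by have [dfv Cdf] := df v; split => //; exact: IH.
Qed.

Lemma CkD (R : realType) (V W : normedModType R) k (f g : V -> W) :
  Ck_on k setT f -> Ck_on k setT g -> Ck_on k setT (fun x => f x + g x).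
Proof.
elim: k f g => [|k IH] f g [cf df] [cg dg]; split;
  try by move=> x xT; apply: continuousD; [exact: cf|exact: cg].
  by [].
move=> v; have [dfv Cf] := df v; have [dgv Cg] := dg v; split=> [x _|].
  by apply: derivableD; [exact: dfv|exact: dgv].
have -> : 'D_v (fun x => f x + g x) = (fun x => 'D_v f x + 'D_v g x).
  by apply/funext => x; rewrite deriveD //; [exact: dfv|exact: dgv].
exact: IH.
Qed.

Lemma CkM (R : realType) (V : normedModType R) k (f g : V -> R) :
  Ck_on k setT f -> Ck_on k setT g -> Ck_on k setT (fun x => f x * g x).
Proof.
elim: k f g => [|k IH] f g Cf Cg.
  by split=> // x xT; apply: continuousM; [exact: Cf.1|exact: Cg.1].
split=> [x xT|v]; first by apply: continuousM; [exact: Cf.1|exact: Cg.1].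
have [dfv Cdf] := Cf.2 v; have [dgv Cdg] := Cg.2 v; split=> [x _|].
  by apply: derivableM; [exact: dfv|exact: dgv].
have -> : 'D_v (fun x => f x * g x) = (fun x => f x * 'D_v g x + g x * 'D_v f x).
  by apply/funext => x; rewrite deriveM //; [exact: dfv|exact: dgv].
by apply: CkD; apply: IH => //; exact: Ck_on_le.
Qed.

Lemma Ck_cst (R : realType) (V W : normedModType R) k (a : W) :
  Ck_on k setT (fun _ : V => a).
Proof.
elim: k a => [|k IH] a; split=> //; try by move=> x _; exact: cst_continuous.
move=> v; split=> [x _|]; first exact: derivable_cst.
have -> : 'D_v (fun _ : V => a) = (fun _ => 0).
  by apply/funext => x; rewrite derive_cst.
exact: IH.
Qed.

Lemma Ck_scalel (R : realType) (V W : normedModType R) k (f : V -> R) (a : W) :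
  Ck_on k setT f -> Ck_on k setT (fun x => f x *: a).
Proof.
elim: k f => [|k IH] f [cf df]; split=> //;
  try by move=> x xT; apply: continuousZr_tmp; exact: cf.
move=> v; have [dfv Cf] := df v.
have H x : is_derive x v (fun x => f x *: a) ('D_v f x *: a).
  have E : (fun h : R => h^-1 *: (((fun x => f x *: a) \o shift x) (h *: v) - f x *: a)) =
      (fun h => (h^-1 *: ((f \o shift x) (h *: v) - f x)) *: a).
    by apply/funext => h /=; rewrite -scalerBl scalerA.
  have C : (fun h => (h^-1 *: ((f \o shift x) (h *: v) - f x)) *: a) @ 0^' --> 'D_v f x *: a.
    by apply: cvgZr_tmp; exact: dfv.
  split; first by rewrite /derivable E; apply/cvg_ex; exists ('D_v f x *: a).
  by rewrite /derive E; apply/cvg_lim.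
split=> [x _|]; first by have [] := H x.
have -> : 'D_v (fun x => f x *: a) = (fun x => 'D_v f x *: a).
  by apply/funext => x; have [] := H x.
exact: IH.
Qed.

(** A map into row vectors is the sum of its coordinates times the basis vectors. *)
Lemma Ck_rV (R : realType) (V : normedModType R) k n (f : V -> 'rV[R]_n) :
  (forall i, Ck_on k setT (fun x => f x 0 i)) -> Ck_on k setT f.
Proof.
move=> Cf.
have -> : f = (fun x => \sum_i (f x 0 i *: delta_mx 0 i)).
  by apply/funext => x; rewrite [LHS]row_sum_delta.
elim: (index_enum _) => [|i s IH].
  by under eq_fun do rewrite big_nil; exact: Ck_cst.
by under eq_fun do rewrite big_cons; apply: CkD => //; exact: Ck_scalel.
Qed.

Lemma Ck_linear (R : realType) (V W : normedModType R) k (f : V -> W) :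
  linear f -> continuous f -> Ck_on k setT f.
Proof.
move=> lf cf; case: k => [|k]; split=> // v.
have H x : is_derive x v f (f v).
  have C : (fun h : R => h^-1 *: ((f \o shift x) (h *: v) - f x)) @ 0^' --> f v.
    apply: cvg_near_cst; apply: filterS (nbhs_dnbhs_neq (0 : R)) => h h0 /=.
    by rewrite lf addrK scalerA mulVf // scale1r.
  split; first by rewrite /derivable; apply/cvg_ex; exists (f v).
  by rewrite /derive; apply/cvg_lim.
split=> [x _|]; first by have [] := H x.
have -> : 'D_v f = (fun _ => f v) by apply/funext => x; have [] := H x.
exact: Ck_cst.
Qed.

(** A basis: balls with rational centres and radii 1/(k+1). *)
Lemma rV_second_countable (R : realType) n : @second_countable 'rV[R]_n.
Proof.
pose f (qk : 'rV[rat]_n * nat) : set 'rV[R]_n :=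
  @ball R 'rV[R]_n (map_mx ratr qk.1) qk.2.+1%:R^-1.
exists (range f); first exact: (sub_countable (card_image_le _ _)).
split=> [_ [qk _ <-]|x V /nbhs_ballP[d /= d0 dV]].
  by apply: ball_open; rewrite invr_gt0.
have [//|N] := @ltr_add_invr R 0 (d / 2) _.
  by rewrite divr_gt0.
rewrite add0r => Nd.
have N0 : (0 : R) < N.+1%:R^-1 by rewrite invr_gt0.
have /choice[q qx] : forall i, exists q : rat, `|x 0 i - ratr q| < N.+1%:R^-1.
  move=> i; have /rat_in_itvoo[q] : x 0 i - N.+1%:R^-1 < x 0 i + N.+1%:R^-1.
    by rewrite ltrD2l gtrN.
  by move=> /itvP qx; exists q; rewrite distrC ltr_distl !qx.
have fx : f (\row_i q i, N) x.
  split=> // i j; rewrite ord1 !mxE.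
    by rewrite -ball_normE /ball_ /= distrC; exact: qx.
exists (f (\row_i q i, N)); first by split=> //; exists (\row_i q i, N).
move=> y fy; apply: dV; rewrite [d]splitr.
apply: (@ball_triangle R 'rV[R]_n (map_mx ratr (\row_i q i))).
  by apply: ball_sym; exact: (le_ball (ltW Nd)).
exact: (le_ball (ltW Nd)).
Qed.

(** * A smooth diassociative loop that is not Moufang *)

Section Model.
Variable R : realType.

Section EuclideanSpace.
Variable n : nat.

Definition id_chart : chart R n 'rV[R]_n.
Proof.
refine (@Chart R n 'rV[R]_n setT id id openT _ _ _ _) => //;
  try by move=> x _; exact: cvg_id.
by rewrite image_id; exact: openT.
Defined.

Definition euclidean_space : smooth_manifold R.
Proof.
refine (@SmoothManifold R 'rV[R]_n n [set id_chart] _ _ _ _).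
- exact: norm_hausdorff.
- exact: rV_second_countable.
- by move=> x; exists id_chart.
- move=> _ _ -> -> k /=; rewrite setTI image_id.
  by apply: Ck_linear => // x; exact: cvg_id.
Defined.

Lemma smooth_op_coord (f : 'rV[R]_n -> 'rV[R]_n -> 'rV[R]_n) :
  (forall k i, Ck_on k setT (fun u : 'rV[R]_n * 'rV[R]_n => f u.1 u.2 0 i)) ->
  @smooth_op_on R euclidean_space setT f.
Proof.
move=> Cf.
have Ck k : Ck_on k setT (fun u : 'rV[R]_n * 'rV[R]_n => f u.1 u.2).
  by apply: Ck_rV => i; exact: Cf.
split; first by case: (Ck 0%N).
move=> _ _ _ -> -> -> k /=.
rewrite (_ : [set u | _] = setT); first exact: Ck.
by apply/seteqP; split=> // u _; split=> //; [exists u.1|exists u.2].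
Qed.

End EuclideanSpace.

Definition row6 (a b c d e f : R) : 'rV[R]_6 :=
  \row_j nth 0 [:: a; b; c; d; e; f] j.

Definition entry (u : 'rV[R]_6) (k : nat) : R := u 0 (inord k).

Lemma entry_row6 a b c d e f : (entry (row6 a b c d e f) 0 = a) *
  (entry (row6 a b c d e f) 1 = b) * (entry (row6 a b c d e f) 2 = c) *
  (entry (row6 a b c d e f) 3 = d) * (entry (row6 a b c d e f) 4 = e) *
  (entry (row6 a b c d e f) 5 = f).
Proof. by rewrite /entry !mxE !inordK. Qed.

Lemma eq_row6 (u : 'rV[R]_6) a b c d e f :
  entry u 0 = a -> entry u 1 = b -> entry u 2 = c -> entry u 3 = d -> entry u 4 = e ->
  entry u 5 = f -> u = row6 a b c d e f.
Proof.
move=> <- <- <- <- <- <-; apply/rowP => j; rewrite mxE -[in LHS](inord_val j).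
by case: j => [[|[|[|[|[|[|]]]]]]].
Qed.

Definition det2 u v := entry u 0 * entry v 1 - entry v 0 * entry u 1.
Definition quad (z z' : R) := z ^+ 2 + 3 * z * z' + 3 * z' ^+ 2.

(** With z and z' the heights of u and v, the cocycle det2 * (1, z + 2 z', quad z z')
    is, up to scaling the coordinates of M, the integral over the triangle
    0, u, u + v in R^3 of exp (s N) dx dy, where x and y are the first two coordinates,
    N generates the action on M and s is the height of u + v minus that of the
    point. By Stokes its coboundary is an integral over a tetrahedron, which
    vanishes on coplanar triples. The binomial weights 3, 4, 6 of the action come from
    the same scaling, which clears all denominators. *)
Definition mul6 u v := row6
  (entry u 0 + entry v 0) (entry u 1 + entry v 1) (entry u 2 + entry v 2)
  (entry u 3 + entry v 3 + det2 u v)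
  (entry u 4 + 3 * entry v 2 * entry u 3 + entry v 4 + det2 u v * (entry u 2 + 2 * entry v 2))
  (entry u 5 + 4 * entry v 2 * entry u 4 + 6 * entry v 2 ^+ 2 * entry u 3 + entry v 5
    + det2 u v * quad (entry u 2) (entry v 2)).

Definition ldiv6 u w := let z := entry w 2 - entry u 2 in row6
  (entry w 0 - entry u 0) (entry w 1 - entry u 1) z
  (entry w 3 - entry u 3 - det2 u w)
  (entry w 4 - entry u 4 - 3 * z * entry u 3 - det2 u w * (entry u 2 + 2 * z))
  (entry w 5 - entry u 5 - 4 * z * entry u 4 - 6 * z ^+ 2 * entry u 3
    - det2 u w * quad (entry u 2) z).

Definition rdiv6 w v :=
  let z := entry w 2 - entry v 2 in
  let k3 := entry w 3 - entry v 3 - det2 w v in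
  let k4 := entry w 4 - entry v 4 - 3 * entry v 2 * k3 - det2 w v * (z + 2 * entry v 2) in
  row6 (entry w 0 - entry v 0) (entry w 1 - entry v 1) z k3 k4
    (entry w 5 - entry v 5 - 4 * entry v 2 * k4 - 6 * entry v 2 ^+ 2 * k3
      - det2 w v * quad z (entry v 2)).

Lemma row6_eta (u : 'rV[R]_6) :
  u = row6 (entry u 0) (entry u 1) (entry u 2) (entry u 3) (entry u 4) (entry u 5).
Proof. exact: eq_row6. Qed.

Lemma mul6_1l u : mul6 0 u = u.
Proof.
by rewrite [RHS]row6_eta; apply: eq_row6; rewrite !entry_row6 /det2 /quad /entry !mxE; ring.
Qed.

Lemma mul6_1r u : mul6 u 0 = u.
Proof.
by rewrite [RHS]row6_eta; apply: eq_row6; rewrite !entry_row6 /det2 /quad /entry !mxE; ring.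
Qed.

Lemma mul6K u v : ldiv6 u (mul6 u v) = v.
Proof.
rewrite [RHS]row6_eta; apply: eq_row6; rewrite !entry_row6 /det2 /quad ?entry_row6; ring.
Qed.

Lemma ldiv6K u v : mul6 u (ldiv6 u v) = v.
Proof.
rewrite [RHS]row6_eta; apply: eq_row6; rewrite !entry_row6 /det2 /quad ?entry_row6; ring.
Qed.

Lemma mul6Kr u v : rdiv6 (mul6 u v) v = u.
Proof.
rewrite [RHS]row6_eta; apply: eq_row6; rewrite !entry_row6 /det2 /quad ?entry_row6; ring.
Qed.

Lemma rdiv6K u v : mul6 (rdiv6 u v) v = u.
Proof.
rewrite [RHS]row6_eta; apply: eq_row6; rewrite !entry_row6 /det2 /quad ?entry_row6; ring.
Qed.

Lemma Ck_entry1 k i : Ck_on k setT (fun u : 'rV[R]_6 * 'rV[R]_6 => entry u.1 i).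
Proof.
apply: Ck_linear => [a u v|u]; first by rewrite /entry !mxE.
apply: (@continuous_comp _ _ _ fst (fun x : 'rV[R]_6 => entry x i)).
  exact: cvg_fst.
exact: coord_continuous.
Qed.

Lemma Ck_entry2 k i : Ck_on k setT (fun u : 'rV[R]_6 * 'rV[R]_6 => entry u.2 i).
Proof.
apply: Ck_linear => [a u v|u]; first by rewrite /entry !mxE.
apply: (@continuous_comp _ _ _ snd (fun x : 'rV[R]_6 => entry x i)).
  exact: cvg_snd.
exact: coord_continuous.
Qed.

Lemma CkN (V : normedModType R) k (f : V -> R) :
  Ck_on k setT f -> Ck_on k setT (fun x => - f x).
Proof.
move=> Cf; under eq_fun do rewrite -mulN1r.
by apply: CkM => //; exact: Ck_cst.
Qed.

Local Ltac Ck_poly := repeat first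
  [ exact: Ck_entry1 | exact: Ck_entry2 | exact: Ck_cst | apply: CkD | apply: CkN
  | apply: CkM ].

Lemma Ck_row6 (V : normedModType R) k (a b c d e f : V -> R) :
  Ck_on k setT a -> Ck_on k setT b -> Ck_on k setT c -> Ck_on k setT d ->
  Ck_on k setT e -> Ck_on k setT f ->
  forall i, Ck_on k setT (fun x => row6 (a x) (b x) (c x) (d x) (e x) (f x) 0 i).
Proof.
move=> Ca Cb Cc Cd Ce Cf i; under eq_fun do rewrite mxE.
by case: i => [[|[|[|[|[|[|]]]]]]].
Qed.

Lemma smooth_mul6 : @smooth_op_on R (euclidean_space 6) setT mul6.
Proof.
apply: smooth_op_coord => k; apply: Ck_row6;
  rewrite /det2 /quad ?expr2; Ck_poly.
Qed.

Lemma smooth_ldiv6 : @smooth_op_on R (euclidean_space 6) setT ldiv6.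
Proof.
apply: smooth_op_coord => k; apply: Ck_row6;
  rewrite /det2 /quad ?expr2; Ck_poly.
Qed.

Lemma smooth_rdiv6 : @smooth_op_on R (euclidean_space 6) setT rdiv6.
Proof.
apply: smooth_op_coord => k; apply: Ck_row6;
  rewrite /det2 /quad ?expr2; Ck_poly.
Qed.

Definition total_op (f : 'rV[R]_6 -> 'rV[R]_6 -> 'rV[R]_6)
    (sf : @smooth_op_on R (euclidean_space 6) setT f) :
  @local_op R (euclidean_space 6) 0 :=
  @LocalOp R (euclidean_space 6) 0 setT f openT I sf.

Definition model : local_loop R.
Proof.
refine (@LocalLoop R (euclidean_space 6) 0 (total_op smooth_mul6)
  (total_op smooth_ldiv6) (total_op smooth_rdiv6) _ _ _ _ _ _);
  apply: filterE => /=; [exact: mul6_1r|exact: mul6_1l|move=> p..].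
- exact: mul6K.
- exact: ldiv6K.
- exact: mul6Kr.
- exact: rdiv6K.
Defined.

Lemma model_eval (v : nat -> model) t : Defs.eval v t = Some (teval v t).
Proof.
by elim: t => [i|| s IHs t IHt | s IHs t IHt | s IHs t IHt] //=;
  rewrite IHs IHt /op_apply /= in_setT.
Qed.

(** The part of M in which associators live. *)
Definition mvec (p q : R) := row6 0 0 0 0 p q.

Definition det3 u v w :=
  det2 u v * entry w 2 - det2 u w * entry v 2 + det2 v w * entry u 2.

Local Ltac row6_ring :=
  apply: eq_row6; rewrite /mvec ?entry_row6 /det3 /det2 /quad ?entry_row6; ring.

Lemma assoc6 u v w :
  ldiv6 (mul6 u (mul6 v w)) (mul6 (mul6 u v) w) =
  mvec (det3 u v w) (det3 u v w * (entry u 2 + 2 * entry v 2 + 3 * entry w 2)).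
Proof. row6_ring. Qed.

Lemma conj6 p q v : ldiv6 v (mul6 (mvec p q) v) = mvec p (q + 4 * entry v 2 * p).
Proof. row6_ring. Qed.

Lemma conjV6 p q v : rdiv6 (mul6 v (mvec p q)) v = mvec p (q - 4 * entry v 2 * p).
Proof. row6_ring. Qed.

Lemma mul_mvec p q p' q' : mul6 (mvec p q) (mvec p' q') = mvec (p + p') (q + q').
Proof. row6_ring. Qed.

Lemma mvec00 : mvec 0 0 = 0.
Proof. by apply/esym/eq_row6; rewrite /entry mxE. Qed.

Lemma model_associator_identities i : associator_identities i -> satisfies model i.
Proof.
move=> Ei; exists setT; first exact: filterT.
move=> v _; rewrite !model_eval; eexists; first reflexivity.
congr Some; move: Ei.
move=> [->|[->|[->|[->|[->|->]]]]] /=;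
  rewrite !(assoc6, conj6, conjV6, mul_mvec);
  rewrite -?mvec00; congr mvec; rewrite /det3 /det2 ?entry_row6; ring.
Qed.

(** ((x y) x) z and x (y (x z)) are compared on three multiples, by a small t, of
    vectors of the standard basis of R^3, where they differ by t^4 in the last
    coordinate. *)
Lemma model_not_moufang : ~ local_moufang model.
Proof.
move=> /satisfies_teval [U /nbhs_ballP[d /= d0 dU] UM].
pose t := d / 2.
have td : 0 < t < d by rewrite divr_gt0 //= ltr_pdivrMr // mulr_natr mulr2n ltrDl.
have ball_row6 a b c : 0 <= a < d -> 0 <= b < d -> 0 <= c < d ->
    U (row6 a b c 0 0 0).
  move=> /andP[a0 ad] /andP[b0 bd] /andP[c0 cd]; apply: dU; split=> // i j.
  rewrite ord1 !mxE -ball_normE /ball_ /= sub0r normrN.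
  by case: j => [[|[|[|[|[|[|]]]]]] ] //= _; rewrite ?normr0 // ger0_norm.
have /andP[t0 td'] := td.
have tP : 0 <= t < d by rewrite ltW.
have zP : 0 <= (0 : R) < d by rewrite lexx.
pose v (k : nat) : model := match k with
  | 0 => row6 0 0 t 0 0 0
  | 1 => row6 t 0 0 0 0 0
  | _ => row6 0 t 0 0 0 0 end.
have /UM : forall k, U (v k) by move=> [|[|k]]; exact: ball_row6.
move=> /(congr1 (fun x => entry x 5)) /=.
rewrite !entry_row6 /det2 /quad !entry_row6 => E.
have : t ^+ 4 = 0 by move: E => /eqP; rewrite -subr_eq0 => /eqP; lra.
by move/eqP; rewrite expf_eq0 /= gt_eqF.
Qed.

End Model.

Theorem corollary1 (R : realType) :
  exists W : local_loop R -> Prop,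
    [/\ is_variety W,
        exists2 Q : local_loop R, W Q & ~ local_moufang Q &
        forall Q : local_loop R, W Q -> moufang_theorem_holds Q].
Proof.
exists (fun Q => forall i, associator_identities i -> satisfies Q i); split.
- exists associator_identities => Q; split=> [QE|[_]//]; split=> //.
  have [U nU [alt gen]] := moufang_theorem_of_identities QE.
  exists U => // a b Ua Ub.
  by rewrite -(setUid [set a]); apply: gen => //; exact: alt.
- by exists (model R); [exact: model_associator_identities|exact: model_not_moufang].
- move=> Q QE; have [U nU [_ gen]] := moufang_theorem_of_identities QE.
  by exists U => // a b c Ua Ub Uc [_ _ _ _]; exact: gen.
Qed.
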